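(* For every tree $T$ of order $n$, $C_2(T)\le \frac{n}{2}+1$.
   Context: All graphs are finite, simple and undirected. A set $S\subseteq V(G)$ is a $2$-dominating set of $G$ if every vertex of $V(G)\setminus S$ has at least $2$ neighbours in $S$. Two sets $U_1,U_2\subseteq V(G)$ form a $2$-coalition if neither $U_1$ nor $U_2$ is a $2$-dominating set of $G$, but $U_1\cup U_2$ is. A $2$-coalition partition of $G$ is a partition $\Theta$ of $V(G)$ into nonempty sets such that every set of $\Theta$ either is a $2$-dominating set of $G$ with exactly $2$ elements, or forms a $2$-coalition with some other set of $\Theta$. The $2$-coalition number $C_2(G)$ is the maximum number of sets in a $2$-coalition partition of $G$. *)

(* Defs.v *)
From mathcomp Require Import all_boot all_order all_algebra.

Set Implicit Arguments.
Unset Strict Implicit.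
Unset Printing Implicit Defensive.

(* A finite simple graph on the vertex type V is an adjacency relation e. *)
Definition simple_graph (V : finType) (e : rel V) : Prop :=
  symmetric e /\ irreflexive e.

Definition connected_graph (V : finType) (e : rel V) : Prop :=
  0 < #|V| /\ forall x y : V, connect e x y.

(* The bound on the size excludes the closed walks x, y, x along an edge,
   which ucycle counts as cycles. *)
Definition acyclic_graph (V : finType) (e : rel V) : Prop :=
  forall c : seq V, 2 < size c -> ~ ucycle e c.

Definition is_tree (V : finType) (e : rel V) : Prop :=
  [/\ simple_graph e, connected_graph e & acyclic_graph e].

Definition two_dominating (V : finType) (e : rel V) (S : {set V}) : bool :=
  [forall v in ~: S, 2 <= #|[set u in S | e v u]|].

Definition two_coalition (V : finType) (e : rel V) (U1 U2 : {set V}) : bool :=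
  [&& ~~ two_dominating e U1, ~~ two_dominating e U2
    & two_dominating e (U1 :|: U2)].

(* The library's partition already requires all the blocks to be nonempty. *)
Definition two_coalition_partition
    (V : finType) (e : rel V) (P : {set {set V}}) : bool :=
  partition P [set: V] &&
  [forall U in P,
     (two_dominating e U && (#|U| == 2))
     || [exists W in P, (W != U) && two_coalition e U W]].

(* The value is 0 when there is no 2-coalition partition, as for the
   one-vertex graph. *)
Definition two_coalition_number (V : finType) (e : rel V) : nat :=
  \max_(P : {set {set V}} | two_coalition_partition e P) #|P|.

(* Main.v *)
Require Import Defs.
From mathcomp Require Import all_boot all_order all_algebra.
From mathcomp Require Import zify lra.
Import Order.TTheory GRing.Theory Num.Theory.
Local Open Scope ring_scope.

(** If no two blocks form a 2-coalition, all blocks have two elements and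
  k = n/2. Otherwise, let U1 and U2 form a 2-coalition, S be their union and
  D its complement. Every vertex of D sends two edges to S and a tree has n - 1
  edges, so 2|D| <= n - 1, and k <= |D| + 2 gives 2k <= n + 3. If 2k = n + 3,
  both bounds are tight: S is independent and the blocks inside D are
  singletons. The partner of such a block {v} is not another singleton, as then
  n <= 3; and it is not U1 (nor U2), as a vertex of U2 has no neighbour in U1,
  hence at most one in {v} + U1. *)

Section Arcs.
Set Implicit Arguments.
Unset Strict Implicit.
Local Open Scope nat_scope.
Variables (V : finType) (e : rel V).
Implicit Types (A B S : {set V}) (x y : V).

Definition neighbours_in B x : {set V} := [set y in B | e x y].

(** Edges are counted as ordered pairs, so [arcs A A] is twice the number of edges inside [A]. *)
Definition arcs A B : nat := \sum_(x in A) #|neighbours_in B x|.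

Lemma arcsE A B : arcs A B = \sum_(x in A) \sum_(y in B) e x y.
Proof.
apply: eq_bigr => x _; rewrite -sum1_card big_mkcond [RHS]big_mkcond /=.
by apply: eq_bigr => y _; rewrite inE; case: (y \in B); case: (e x y).
Qed.

Lemma arcs_sym A B : symmetric e -> arcs A B = arcs B A.
Proof.
move=> esym; rewrite !arcsE exchange_big /=.
by apply: eq_bigr => x _; apply: eq_bigr => y _; rewrite esym.
Qed.

Lemma arcs_setCr A S : arcs A [set: V] = arcs A S + arcs A (~: S).
Proof.
rewrite /arcs -big_split; apply: eq_bigr => x _ /=.
rewrite -(cardsID S (neighbours_in _ x)); congr (_ + _).
  by apply: eq_card => y; rewrite !inE andbC.
by apply: eq_card => y; rewrite !inE.
Qed.

Lemma arcs_setC S : symmetric e ->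
  arcs [set: V] [set: V] = arcs S S + (arcs (~: S) S).*2 + arcs (~: S) (~: S).
Proof.
move=> esym; rewrite (arcs_setCr _ S) !(arcs_sym [set: V]) // !(arcs_setCr _ S).
by rewrite (arcs_sym S (~: S)) //; lia.
Qed.

Lemma arcs_setD1 A x : simple_graph e -> x \in A ->
  arcs A A = arcs (A :\ x) (A :\ x) + #|neighbours_in A x|.*2.
Proof.
move=> [esym eirr] xA.
have Nx : neighbours_in A x = neighbours_in (A :\ x) x.
  by apply/setP => y; rewrite !inE; case: eqVneq => [->|//]; rewrite eirr !andbF.
have big1E B : arcs [set x] B = #|neighbours_in B x| by rewrite /arcs big_set1.
have arcsD B : arcs A B = #|neighbours_in B x| + arcs (A :\ x) B.
  by rewrite /arcs (big_setD1 x xA).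
by rewrite arcsD (arcs_sym (A :\ x) A) // arcsD -Nx; lia.
Qed.

(* At the end of a longest path, a neighbour other than the next vertex would
   close a cycle. *)
Lemma acyclic_low_degree A : simple_graph e -> acyclic_graph e ->
  A != set0 -> exists2 x, x \in A & #|neighbours_in A x| <= 1.
Proof.
move=> [esym eirr] eacy /set0Pn[a aA].
pose good (s : seq V) := [&& uniq s, all (mem A) s & sorted e s].
(* The parameter [m] is the length in edges of a path inside [A]. *)
pose hasgood m := [exists s : m.+1.-tuple V, good s].
have ex0 : exists m, hasgood m.
  by exists 0; apply/existsP; exists [tuple a]; rewrite /good /= aA.
have bound m : hasgood m -> m <= #|V|.
  case/existsP => s /and3P[us _ _].
  by have := max_card (mem s); rewrite (card_uniqP us) size_tuple; lia.
case: (ex_maxnP ex0 bound) => m /existsP[[[|x p] sz]] //= /and3P[us sA sp] mmax.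
have xA : x \in A by move: sA => /= /andP[].
exists x => //; rewrite leqNgt; apply/negP => /card_gt1P[y [z [Ny Nz yz]]].
(* By maximality, a neighbour off the path cannot be prepended to it. *)
have Np w : w \in neighbours_in A x -> w \in p.
  rewrite inE => /andP[wA exw]; apply: contraT => wp.
  have wx : w != x by apply: contraTneq exw => ->; rewrite eirr.
  suff : hasgood m.+1 by move/mmax; rewrite ltnn.
  apply/existsP; exists (cons_tuple w (Tuple sz)); move: us sA sp.
  rewrite /good /= inE negb_or wx wp wA esym exw /=.
  by move=> -> -> ->.
have [w [Nw wp wh]] :
    exists w, [/\ w \in neighbours_in A x, w \in p & w != head x p].
  case: (eqVneq y (head x p)) => yh; last by exists y; split=> //; apply: Np.
  by exists z; split; rewrite // ?Np // -yh eq_sym.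
move: Nw; rewrite inE => /andP[_ exw].
case: p {sA Np mmax sz} wp wh us sp => [|h q] //=.
rewrite inE => wq wh us sp; move: wq; rewrite (negPf wh) /= => wq.
case/splitPr: wq us sp => q1 q2 us sp.
(* The path from [x] to [w] closes up through the edge [w x]. As [w] is not [h], the cycle has at
   least three vertices. *)
apply: (eacy [:: x, h & rcons q1 w]); first by rewrite /= size_rcons.
rewrite /ucycle; apply/andP; split; last first.
  move: us; rewrite -cat_rcons -!cat_cons.
  rewrite -[_ && _]/(uniq ([:: x, h & rcons q1 w] ++ q2)).
  by rewrite cat_uniq => /andP[].
move: sp; rewrite -cat_rcons cat_path => /and3P[exh pq _] /=.
by rewrite exh rcons_path pq last_rcons esym exw.
Qed.

(** This is the forest bound of |A| - 1 edges, doubled. Removing a vertex of degree at most 1 lowers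
    the left side by at most 2 and the right side by exactly 2. *)
Lemma acyclic_arcs A : simple_graph e -> acyclic_graph e ->
  A != set0 -> arcs A A + 2 <= #|A|.*2.
Proof.
move=> esimple eacy; have [k] := ubnP #|A|; elim: k A => // k IH A Ak A0.
have [x xA dx] := acyclic_low_degree esimple eacy A0.
rewrite (arcs_setD1 esimple xA); have cA := cardsD1 x A; rewrite xA in cA.
have [Ax0 | Axn0] := eqVneq (A :\ x) set0; last by have := IH _ _ Axn0; lia.
(* Here [A] is the single vertex [x], which has no neighbour in [A] since there are no loops. *)
suff -> : neighbours_in A x = set0 by rewrite /arcs Ax0 big_set0 cards0; lia.
apply/setP => y; rewrite !inE; apply/negP => /andP[yA exy].
have : y \in A :\ x.
  by rewrite !inE yA andbT; apply: contraTneq exy => ->; rewrite esimple.2.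
by rewrite Ax0 inE.
Qed.

(** Each vertex outside [S] sends at least two edges to [S], and each edge counts twice, whence the
    factor 4. The term [arcs S S] is kept for the equality case, where it has to vanish. *)
Lemma two_dominating_arcs S : is_tree e -> two_dominating e S ->
  arcs S S + 4 * #|~: S| + 2 <= #|V|.*2.
Proof.
move=> [esimple [V0 _] eacy] /forall_inP domS.
have := acyclic_arcs esimple eacy (A := [set: V]).
rewrite -card_gt0 cardsT (arcs_setC S esimple.1) => /(_ V0).
suff : 2 * #|~: S| <= arcs (~: S) S by lia.
by rewrite mulnC -sum_nat_const; apply: leq_sum => x /domS.
Qed.

End Arcs.

Section Partitions.
Set Implicit Arguments.
Unset Strict Implicit.
Local Open Scope nat_scope.
Variables (V : finType) (P : {set {set V}}) (D : {set V}).
Hypothesis partP : partition P D.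

Lemma leq_card_partition : #|P| <= #|D|.
Proof.
rewrite (card_partition partP) -sum1_card; apply: leq_sum => B BP.
by rewrite card_gt0 (partition_neq0 partP).
Qed.

(** The block sizes are at least 1 and add up to |D|, so no block can exceed 1. *)
Lemma card_partition_singletons B : #|D| <= #|P| -> B \in P -> #|B| = 1.
Proof.
move=> DP BP; apply/eqP; rewrite eqn_leq card_gt0 (partition_neq0 partP BP) andbT.
move: DP; rewrite (card_partition partP) (big_setD1 B BP) (cardsD1 B P) BP /=.
move=> DP; rewrite -(leq_add2r #|P :\ B|); apply: leq_trans DP; rewrite leq_add2l.
rewrite -sum1_card; apply: leq_sum => C /setD1P[_ CP].
by rewrite card_gt0 (partition_neq0 partP CP).
Qed.

End Partitions.

Section Tree.
Set Implicit Arguments.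
Unset Strict Implicit.
Local Open Scope nat_scope.
Variables (V : finType) (e : rel V).
Implicit Types (U S : {set V}) (P : {set {set V}}).

(** A vertex [u] of [U2] has no neighbour in [U1], so [v] is its only possible neighbour in
    [v |: U1]. *)
Lemma independent_not_two_dominating U1 U2 v :
  arcs e (U1 :|: U2) (U1 :|: U2) = 0 -> U2 != set0 -> [disjoint U1 & U2] ->
  v \notin U2 -> ~~ two_dominating e (v |: U1).
Proof.
move=> /eqP; rewrite sum_nat_eq0 => /forallP indep /set0Pn[u uU2] dis vU2.
apply/negP => /forall_inP/(_ u).
have uU1 : u \notin U1 by rewrite (disjointFl dis uU2).
have uv : u != v by apply: contraNneq vU2 => <-.
rewrite !inE negb_or uv uU1 => /(_ isT) /card_gt1P[y [z []]].
suff eqv w : w \in [set w in v |: U1 | e u w] -> w = v.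
  by move=> /eqv-> /eqv->; rewrite eqxx.
rewrite !inE => /andP[/predU1P[//|wU1] euw].
have := indep u; rewrite inE uU2 orbT /= cards_eq0 => /eqP/setP/(_ w).
by rewrite !inE wU1 euw.
Qed.

Lemma coalition_partition_bound P U1 U2 : is_tree e ->
  two_coalition_partition e P -> U1 \in P -> U2 \in P ->
  two_coalition e U1 U2 -> 2 * #|P| <= #|V| + 2.
Proof.
move=> eT /andP[partP /forall_inP coal] U1P U2P /and3P[nU1 nU2 domS].
have U12 : U1 != U2.
  by apply: contraNneq nU1 => U12; move: domS; rewrite U12 setUid.
have dis : [disjoint U1 & U2] by case/and3P: partP => _ /trivIsetP->.
set S := U1 :|: U2 in domS.
have U2P1 : U2 \in P :\ U1 by rewrite !inE eq_sym U12 U2P.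
have partD : partition (P :\ U1 :\ U2) (~: S).
  by rewrite -setTD /S -setDDl; exact: partitionD1 (partitionD1 partP U1P) U2P1.
have cP : #|P| = #|P :\ U1 :\ U2| + 2.
  by rewrite (cardsD1 U1 P) U1P (cardsD1 U2 (P :\ U1)) U2P1 addn2.
have lePD := leq_card_partition partD.
have arcsS := two_dominating_arcs eT domS.
rewrite leqNgt; apply/negP => big.
have leDP : #|~: S| <= #|P :\ U1 :\ U2| by lia.
have indep : arcs e S S = 0 by lia.
have singl := card_partition_singletons partD leDP.
have [B BP] : exists B, B \in P :\ U1 :\ U2.
  apply/set0Pn; rewrite -card_gt0.
  have := leq_card_partition partP; rewrite cardsT; lia.
have /cards1P[v Bv] : #|B| == 1 by rewrite singl.
have vS : v \notin S.
  rewrite -in_setC -(cover_partition partD); apply/bigcupP.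
  by exists B; rewrite // Bv set11.
move: vS; rewrite inE negb_or => /andP[vU1 vU2].
have BP0 : B \in P by move: BP; rewrite !inE => /and3P[].
(* A singleton is not a pair, so [B] must have a coalition partner [W]. *)
have := coal B BP0; rewrite singl // andbF /= => /exists_inP[W WP].
case/andP => WB /and3P[_ _]; rewrite Bv.
have [-> | WU1] := eqVneq W U1.
  by apply/negP/(independent_not_two_dominating (U2 := U2)) => //;
    exact: (partition_neq0 partP).
have [-> | WU2] := eqVneq W U2.
  apply/negP/(independent_not_two_dominating (U2 := U1)) => //.
  - by rewrite setUC.
  - exact: (partition_neq0 partP).
  - by rewrite disjoint_sym.
have WP' : W \in P :\ U1 :\ U2 by rewrite !inE WU1 WU2.
(* Were the pair [v |: W] 2-dominating, the edge count would give |V| <= 3. But two blocks outside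
   [S] force |V| >= 5. *)
have cVW : #|V| <= #|~: (v |: W)| + 2.
  rewrite -(cardsC (v |: W)) addnC leq_add2l cardsU1 singl //.
  by case: (v \notin W).
have P2 : 1 < #|P :\ U1 :\ U2| by apply/card_gt1P; exists W, B.
by move/(two_dominating_arcs eT) => arcsW; clear -arcsS arcsW cVW P2 lePD; lia.
Qed.

Lemma two_coalition_partition_bound P : is_tree e ->
  two_coalition_partition e P -> 2 * #|P| <= #|V| + 2.
Proof.
move=> eT coalP; have /andP[partP /forall_inP coal] := coalP.
(* Either some block has a coalition partner, or all blocks are pairs and their sizes add up to
   2|P|. *)
have [[U UP /exists_inP[W WP /andP[_ UW]]] | all2] :=
    exists_inP (P := [pred U | [exists W in P, (W != U) && two_coalition e U W]])
               (D := mem P).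
  exact: coalition_partition_bound eT coalP UP WP UW.
rewrite -cardsT (card_partition partP) mulnC -sum_nat_const.
apply: leq_trans (leq_addr _ _); apply: leq_sum => U UP.
have /orP[/andP[_ /eqP->//]|UW] := coal U UP.
by case: all2; exists U.
Qed.

End Tree.

Theorem theorem12 (V : finType) (T : rel V) (n : nat)
    (T_tree : is_tree T) (T_order : #|V| = n) :
  (two_coalition_number T)%:R <= n%:R / 2%:R + 1 :> rat.
Proof.
have bound : (2 * two_coalition_number T <= n + 2)%N.
  (* Halving leaves the maximum alone on the left, so that it can be bounded partition by
     partition. *)
  suff : (two_coalition_number T <= (n + 2)./2)%N by lia.
  apply/bigmax_leqP => P /(two_coalition_partition_bound T_tree); lia.
move: bound; rewrite -(ler_nat rat) natrM natrD; lra.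
Qed.
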